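(* Let $n \ge 1$. Every element of the alternating group $A_n$ is a commutator of a pair of elements of $S_n$; that is, for every $\sigma \in A_n$ there exist $\alpha, \beta \in S_n$ such that $\sigma = [\alpha, \beta]$.
   Context: $S_n$ is the symmetric group on $\{1, \dots, n\}$, $A_n$ is its subgroup of even permutations, and $[\alpha, \beta] = \alpha \beta \alpha^{-1} \beta^{-1}$. *)

(* Defs.v *)
From mathcomp Require Import ssreflect fintype fingroup perm alt.

Set Implicit Arguments.
Unset Strict Implicit.
Unset Printing Implicit Defensive.

(* The commutator a * b * a^-1 * b^-1.  The library's [~ a, b] is instead
   a^-1 * b^-1 * a * b. *)
Definition lcommg (gT : groupType) (a b : gT) : gT :=
  (a * b * a^-1 * b^-1)%g.

(* Main.v *)
Require Import Defs.
From mathcomp Require Import ssreflect ssrfun ssrbool eqtype ssrnat fintype finset fingroup perm alt.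

(** It suffices to write sigma = r * t with t conjugate to r^-1.  This is done
    for all permutations at once, by induction on the support: an even s is such
    a product, while for an odd s the factor t is conjugate to r^-1 times a
    transposition of two fixed points of r.  In both cases a prescribed point is
    fixed by r.  To insert a point x right after y in a cycle, take
    a factorisation r * t of the shorter permutation with r y = y: then
    (x y) * r * t = t * (r * (x y)) ^ t, and t fixes x. *)

Set Implicit Arguments.
Unset Strict Implicit.
Unset Printing Implicit Defensive.

Section NearInverseFactorisation.

Local Open Scope group_scope.

Variable T : finType.
Implicit Types (A B : {set T}) (r s t b : {perm T}) (x y z w : T).

Lemma tperm_fixC r x y : r x = x -> r y = y -> r * tperm x y = tperm x y * r.
Proof. by move=> rx ry; rewrite [RHS]conjgC tpermJ rx ry. Qed.

Lemma conjg_tperm_id r x y : r x = x -> r y = y -> r ^ tperm x y = r.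
Proof. by move=> rx ry; rewrite /conjg (tperm_fixC rx ry) mulKg. Qed.

Lemma perm_on_tperm A x y : x \in A -> y \in A -> perm_on A (tperm x y).
Proof.
move=> xA yA; apply/subsetP=> z; rewrite inE.
by case: tpermP => [->|->|] //; rewrite eqxx.
Qed.

Lemma perm_onW A B s : A \subset B -> perm_on A s -> perm_on B s.
Proof. by move=> sAB sA; apply: subset_trans sA sAB. Qed.

Lemma perm_onD1 A s x : perm_on A s -> s x = x -> perm_on (A :\ x) s.
Proof.
move=> sA sx; apply/subsetP=> z; rewrite !inE => sz; apply/andP; split.
  by apply: contraNneq sz => ->; rewrite sx.
by apply: contraR sz => zA; rewrite (out_perm sA zA).
Qed.

(** By parity, [t] can be conjugate to [r^-1] only for even [s]; [tperm x w] corrects the odd case.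
    The fixed point [x] of [r] is where the induction inserts a new point, and [b] stays inside [A]
    so that it fixes that new point. *)
Definition near_inverse_factorisation A s x r t b :=
  [/\ perm_on A r, perm_on A b, r x = x & s = r * t] /\
  if odd_perm s then
    exists w, [/\ w \in A, w != x, r w = w & (r^-1 * tperm x w) ^ b = t]
  else r^-1 ^ b = t.

Lemma near_inverse_factorisation_fixed A s x z r t b :
    x \in A -> s x = x -> z \in A :\ x ->
  near_inverse_factorisation (A :\ x) s z r t b ->
  exists b', near_inverse_factorisation A s x r t b'.
Proof.
rewrite !inE => xA sx /andP[zx zA] [[rA bA rz defs] tb].
have rx : r x = x by apply: out_perm rA _; rewrite !inE eqxx.
have sub := subsetDl A [set x].
move: tb; rewrite /near_inverse_factorisation; case: odd_perm => /= [[w []] | tb].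
  rewrite !inE => /andP[wx wA] wz rw tb.
  (* [r] fixes [x] and [z], so conjugation by [tperm x z] preserves [r^-1] and only moves
     [tperm x w] to [tperm z w]. *)
  exists (tperm x z * b); split.
    split=> //; first exact: perm_onW rA.
    by apply: perm_onM (perm_onW sub bA); apply: perm_on_tperm.
  exists w; split=> //; rewrite conjgM -tb; congr (_ ^ b).
  rewrite conjMg tpermJ tpermL tpermD 1?eq_sym //.
  by rewrite conjVg (conjg_tperm_id rx rz).
by exists b; split=> //; split=> //; apply: perm_onW sub _.
Qed.

Lemma near_inverse_factorisation_insert A s x y r t b :
    perm_on A s -> y \in A :\ x -> x \in A ->
  near_inverse_factorisation (A :\ x) (tperm x y * s) y r t b ->
  (tperm x y * s) x = x ->
  exists t' b', near_inverse_factorisation A s x t t' b'.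
Proof.
rewrite !inE => sA /andP[yx yA] xA [[rA bA ry defs] tb] s'x.
have sub := subsetDl A [set x].
have xn : x \notin A :\ x by rewrite !inE eqxx.
have rx : r x = x by apply: out_perm rA _.
have bx : b x = x by apply: out_perm bA _.
have tx : t x = x by move: s'x; rewrite defs permM rx.
have tA : perm_on A t.
  have -> : t = r^-1 * (tperm x y * s) by rewrite defs mulKg.
  apply: perm_onM; first by apply: perm_onV; apply: perm_onW sub _.
  by apply: perm_onM sA; apply: perm_on_tperm.
have bVA : perm_on A b^-1 by apply: perm_onV; apply: perm_onW sub _.
have defs2 : s = t * (r * tperm x y) ^ t.
  by rewrite -conjgC (tperm_fixC rx ry) -mulgA -defs mulgA tperm2 mul1g.
exists ((r * tperm x y) ^ t).
(* The extra transposition flips the parity, so the odd case for [s] comes from the even one for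
   [tperm x y * s], and conversely. *)
move: tb; rewrite odd_mul_tperm eq_sym yx /= /near_inverse_factorisation.
case: odd_perm => /= [tb | [w []]].
  (* Conjugation by [b^-1] takes [t^-1] back to [r] and, as [b] fixes [x], [tperm x (b y)] to
     [tperm x y]. That [r] fixes [y] makes [t] fix [b y]. *)
  exists (b^-1 * t); split; first by split=> //; apply: perm_onM.
  exists (b y); split.
  - by rewrite perm_closed //; apply: perm_onW sub _.
  - by rewrite -bx (inj_eq perm_inj).
  - by rewrite -tb permJ -{1}ry permK.
  have tV : t^-1 = r ^ b by rewrite -tb conjVg invgK.
  rewrite conjgM tV; congr (_ ^ t).
  by rewrite conjMg conjgK tpermJ permK -{1}bx permK.
rewrite !inE => /andP[wx wA] wy rw tb.
(* Conjugation by [b^-1] takes [t^-1] to [tperm y w * r]; then [tperm x w], which commutes with [r],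
   turns this into [tperm y x * r], equal to [r * tperm x y]. *)
exists (b^-1 * tperm x w * t); split.
  by split=> //; do !apply: perm_onM => //; apply: perm_on_tperm.
have tV : t^-1 = (tperm y w * r) ^ b.
  by rewrite -tb -conjVg invMg invgK tpermV.
rewrite !conjgM tV conjgK; congr (_ ^ t).
rewrite conjMg (conjg_tperm_id rx rw) tpermJ tpermR.
by rewrite tpermD 1?[x == y]eq_sym // tpermC (tperm_fixC rx ry).
Qed.

Lemma near_inverse_factorisation_exists A s x :
    perm_on A s -> x \in A ->
  exists r t b, near_inverse_factorisation A s x r t b.
Proof.
have [k] := ubnP #|A|; elim: k A s x => // k IHk A s x leAk sA xA.
have ltAk : #|A :\ x| < k by rewrite (cardsD1 x) xA in leAk.
have [sx | sx] := eqVneq (s x) x.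
  have sAx := perm_onD1 sA sx.
  have [A0 | [z zA]] := set_0Vmem (A :\ x).
    have -> : s = 1 by apply: perm_on_id sAx _; rewrite A0 cards0.
    exists 1, 1, 1; split.
      by rewrite mulg1 perm1; split=> //; apply: perm_on1.
    by rewrite odd_perm1 invg1 conj1g.
  have [r [t [b H]]] := IHk _ _ _ ltAk sAx zA.
  by exists r, t; apply: near_inverse_factorisation_fixed sx zA H.
(* Products apply the left factor first, so [tperm x y * s] cuts [x] out of its cycle, just after
   its predecessor [y]. *)
pose y := s^-1 x; have sy : s y = x by rewrite permKV.
have yA : y \in A :\ x.
  rewrite !inE -(perm_closed y sA) sy xA andbT.
  by apply: contraNneq sx => yx; rewrite -{1}yx sy.
have s'x : (tperm x y * s) x = x by rewrite permM tpermL.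
have s'A : perm_on (A :\ x) (tperm x y * s).
  apply: perm_onD1 s'x; apply: perm_onM sA.
  by apply: perm_on_tperm; case/setD1P: yA.
have [r [t [b H]]] := IHk _ _ _ ltAk s'A yA.
by exists t; apply: near_inverse_factorisation_insert H s'x.
Qed.

End NearInverseFactorisation.

Theorem corollary7 (n : nat) (hn : 1 <= n)
    (sigma : 'S_n) (hs : sigma \in ('Alt_('I_n))%g) :
  exists alpha beta : 'S_n, sigma = lcommg alpha beta.
Proof.
have sT : perm_on [set: 'I_n] sigma by apply/subsetP=> z; rewrite inE.
have [r [t [b [[_ _ _ defs] tb]]]] :=
  near_inverse_factorisation_exists sT (in_setT (Ordinal hn)).
move: tb; rewrite Alt_even in hs; rewrite (negbTE hs) => tb.
(* [r * r^-1 ^ b] unfolds to [r * b^-1 * r^-1 * b], hence the inverse in the second witness. *)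
by exists r, (b^-1)%g; rewrite defs -tb /lcommg invgK /conjg !mulgA.
Qed.
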